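(* Let $\mathbb{K}$ be a field. Each of the following graded vector subspaces of $\mathrm{ParQSym}$ is a subcoalgebra: the span of the $M_\pi$ with $\pi$ a matching; the span of the $M_\pi$ with $\pi$ a perfect matching; the span of the $M_\pi$ with $\pi$ a permuting diagram; the span of the $M_\pi$ with $\pi$ a partial permutation.
   Context: **Partition diagrams.** A partition diagram of order $k\ge 0$ is a set partition of $\{1,\dots,k,1',\dots,k'\}$ ($1,\dots,k$ are the upper nodes, $1',\dots,k'$ the lower nodes); for $k=0$ the only one is the empty diagram $\emptyset$. For $\pi$ of order $k$ and $\rho$ of order $m$, $\pi\otimes\rho$ is the diagram of order $k+m$ whose blocks are the blocks of $\pi$ and the blocks of $\rho$ with labels shifted by $k$ ($i\mapsto i+k$, $i'\mapsto (i+k)'$); $\emptyset$ is the unit for $\otimes$. A block is propagating if it contains at least one upper and at least one lower node. A matching is a partition diagram all of whose blocks have size at most two. A perfect matching is a partition diagram all of whose blocks have size two. A permuting diagram is a partition diagram all of whose blocks have size two and are propagating. A partial permutation is a partition diagram all of whose blocks have size one or two and all of whose blocks of size two are propagating. The empty diagram (having no blocks) belongs to all four classes. **Coalgebra ParQSym.** $\mathrm{ParQSym}=\bigoplus_{i\ge0}\mathrm{ParQSym}_i$, where $\mathrm{ParQSym}_i$ is the $\mathbb{K}$-vector space with basis $\{M_\pi:\pi\text{ of order }i\}$. Coproduct: $\Delta M_\sigma=\sum_{\pi\otimes\rho=\sigma}M_\pi\otimes M_\rho$, over all ordered pairs of (possibly empty) diagrams with $\pi\otimes\rho=\sigma$.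 Counit: $\varepsilon(M_\pi)=\delta_{\pi,\emptyset}$. *)

(* Defs.v *)
From HB Require Import structures.
From mathcomp Require Import all_boot all_algebra.
From mathcomp.multinomials Require Import freeg.

Set Implicit Arguments.
Unset Strict Implicit.
Unset Printing Implicit Defensive.

Import GRing.Theory.
Local Open Scope ring_scope.

(* {freeg A / K} is the K-vector space with basis A: <<a>> is the basis vector
   of a, and fglift f is the linear extension of f : A -> V. *)

Section FgliftLinear.
Context (K : nzRingType) (A : choiceType) (V : lmodType K) (f : A -> V).

Fact fglift_additive : zmod_morphism (fglift f : {freeg A / K} -> V).
Proof. exact: lift_is_additive. Qed.

HB.instance Definition _ :=
  GRing.isZmodMorphism.Build {freeg A / K} V (fglift f) fglift_additive.

Fact fglift_scalable : scalable (fglift f : {freeg A / K} -> V).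
Proof.
move=> c x; have liftE y : fglift f y = \sum_(a <- dom y) coeff a y *: f a.
  rewrite -{1}(freeg_sumE y) raddf_sum /=.
  by apply: eq_bigr => a _; rewrite liftU.
rewrite -{1}(freeg_sumE x) [in RHS]liftE !scaler_sumr raddf_sum /=.
apply: eq_bigr => a _; rewrite scalerA -(liftU f); congr fglift.
by apply/eqP/freeg_eqP => b; rewrite coeffZ !coeffU mulrA.
Qed.

HB.instance Definition _ :=
  GRing.isScalable.Build K {freeg A / K} V *:%R (fglift f) fglift_scalable.

Lemma fgliftM a : fglift f << a >> = f a.
Proof. by rewrite liftU scale1r. Qed.

End FgliftLinear.

Lemma fglift_linear_ext (K : nzRingType) (A : choiceType) (V : lmodType K)
    (f g : {linear {freeg A / K} -> V}) :
  (forall a, f << a >> = g << a >>) -> f =1 g.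
Proof.
move=> fg x; rewrite -(freeg_sumE x) !raddf_sum; apply: eq_bigr => a _.
have -> : << coeff a x *g a >> = coeff a x *: << a >> :> {freeg A / K}.
  by apply/eqP/freeg_eqP => b; rewrite coeffZ !coeffU mul1r.
by rewrite /= (linearZZ f) (linearZZ g) fg.
Qed.

Section Tensor.
Context (K : fieldType).

(* The tensor product of the spaces with bases A and B is the space with basis
   A * B; the pure tensor <<a>> (x) <<b>> is <<(a, b)>>. *)
Definition tens (A B : choiceType) (x : {freeg A / K}) (y : {freeg B / K}) :
    {freeg (A * B) / K} :=
  fglift (fun a => fglift (fun b => << (a, b) >>) y) x.

Definition tmap (A B A' B' : choiceType)
    (f : {freeg A / K} -> {freeg A' / K}) (g : {freeg B / K} -> {freeg B' / K}) :
    {freeg (A * B) / K} -> {freeg (A' * B') / K} :=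
  fglift (fun p => tens (f << p.1 >>) (g << p.2 >>)).

Definition tassoc (A B C : choiceType) :
    {freeg (A * B * C) / K} -> {freeg (A * (B * C)) / K} :=
  fglift (fun p => << (p.1.1, (p.1.2, p.2)) >>).

(* Coalgebras over K whose underlying space is given with a basis (over a field
   this is no restriction): coassociativity, then the two counit axioms. *)
Record coalgebra := Coalgebra {
  basis : choiceType;
  comul : {linear {freeg basis / K} -> {freeg (basis * basis) / K}};
  counit : {linear {freeg basis / K} -> K^o};
  _ : forall x, tassoc (tmap comul id (comul x)) = tmap id comul (comul x);
  _ : forall x, fglift (fun p => counit << p.1 >> *: << p.2 >>) (comul x) = x;
  _ : forall x, fglift (fun p => counit << p.2 >> *: << p.1 >>) (comul x) = x
}.

Definition is_subspace (V : lmodType K) (D : V -> Prop) : Prop :=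
  D 0 /\ forall (c : K) (x y : V), D x -> D y -> D (c *: x + y).

Definition in_span (V : lmodType K) (S : V -> Prop) (v : V) : Prop :=
  exists (n : nat) (c : 'I_n -> K) (s : 'I_n -> V),
    (forall i, S (s i)) /\ v = \sum_(i < n) c i *: s i.

(* D (x) D as a subspace of C (x) C, for C with basis A. *)
Definition tens_sub (A : choiceType) (D : {freeg A / K} -> Prop) :
    {freeg (A * A) / K} -> Prop :=
  in_span (fun t => exists x y, [/\ D x, D y & t = tens x y]).

(* No condition on the counit: it restricts to any subspace. *)
Definition is_subcoalgebra (C : coalgebra) (D : {freeg (basis C) / K} -> Prop) :
    Prop :=
  is_subspace D /\ forall x, D x -> tens_sub D (comul C x).

End Tensor.

(* inl i and inr i are the nodes i+1 and (i+1)'. *)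
Definition node (k : nat) : finType := ('I_k + 'I_k)%type.

Definition is_diagram k (P : {set {set node k}}) := partition P [set: node k].

Definition diagram (k : nat) : finType := {P : {set {set node k}} | is_diagram P}.

Definition pdiag : choiceType := {k : nat & diagram k}.

Definition pdiag_order (s : pdiag) : nat := tag s.
Definition blocks (s : pdiag) : {set {set node (pdiag_order s)}} := val (tagged s).

Section DiagramTensor.
Context (k m : nat).

Definition lnode (x : node k) : node (k + m) :=
  match x with inl i => inl (lshift m i) | inr i => inr (lshift m i) end.
Definition rnode (x : node m) : node (k + m) :=
  match x with inl i => inl (rshift k i) | inr i => inr (rshift k i) end.

Definition dtens_blocks (P : {set {set node k}}) (Q : {set {set node m}}) :
    {set {set node (k + m)}} :=
  [set lnode @: B | B : {set node k} in P]
    :|: [set rnode @: B | B : {set node m} in Q].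

Lemma lnode_inj : injective lnode.
Proof. by case=> i [] j //= [] /val_inj ->. Qed.

Lemma rnode_inj : injective rnode.
Proof. by case=> i [] j //= [] /addnI /val_inj ->. Qed.

Lemma lrnode x y : lnode x <> rnode y.
Proof.
by case: x => i; case: y => j //= [] /eqP; rewrite ltn_eqF // ltn_addr.
Qed.

Lemma nodeP (z : node (k + m)) :
  (exists x, z = lnode x) \/ (exists y, z = rnode y).
Proof.
case: z => i; rewrite -(splitK i); case: (split i) => j /=.
- by left; exists (inl j).
- by right; exists (inl j).
- by left; exists (inr j).
- by right; exists (inr j).
Qed.

Fact dtens_subproof (P : diagram k) (Q : diagram m) :
  is_diagram (dtens_blocks (val P) (val Q)).
Proof.
case: P Q => [P /= hP] [Q /= hQ].
case/and3P: hP => /eqP cP tP nP; case/and3P: hQ => /eqP cQ tQ nQ.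
apply/and3P; split.
- apply/eqP/setP => z; rewrite inE; apply/bigcupP.
  have [[x ->]|[y ->]] := nodeP z.
  + have: x \in cover P by rewrite cP inE.
    case/bigcupP => B BP xB; exists (lnode @: B); last exact: imset_f.
    by rewrite inE imset_f.
  + have: y \in cover Q by rewrite cQ inE.
    case/bigcupP => B BQ yB; exists (rnode @: B); last exact: imset_f.
    by rewrite inE imset_f ?orbT.
- apply/trivIsetP => _ _ /setUP[] /imsetP[B hB ->] /setUP[] /imsetP[C hC ->] nBC.
  + rewrite imset_disjoint; last exact: lnode_inj.
    apply: (trivIsetP tP) => //; apply: contraNneq nBC => ->; exact: eqxx.
  + rewrite -setI_eq0; apply/eqP/setP => z; rewrite !inE; apply/negP.
    by case/andP => /imsetP[x _ ->] /imsetP[y _ /lrnode].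
  + rewrite -setI_eq0; apply/eqP/setP => z; rewrite !inE; apply/negP.
    by case/andP => /imsetP[x _ ->] /imsetP[y _ /esym /lrnode].
  + rewrite imset_disjoint; last exact: rnode_inj.
    apply: (trivIsetP tQ) => //; apply: contraNneq nBC => ->; exact: eqxx.
- by apply/negP => /setUP[] /imsetP[B hB] /esym/eqP; rewrite imset_eq0 => /eqP B0;
    move: hB; rewrite B0; apply/negP.
Qed.

Definition dtens (P : diagram k) (Q : diagram m) : diagram (k + m) :=
  Sub (dtens_blocks (val P) (val Q)) (dtens_subproof P Q).

End DiagramTensor.

Definition ptens (p r : pdiag) : pdiag :=
  Tagged diagram (dtens (tagged p) (tagged r)).

Fact is_diagram0 : is_diagram (set0 : {set {set node 0}}).
Proof.
apply/and3P; split; rewrite ?inE //.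
- by rewrite /cover big_set0; apply/eqP/setP; case=> [][].
- by apply/trivIsetP => B C; rewrite inE.
Qed.

Definition pempty : pdiag := Tagged diagram (Sub set0 is_diagram0 : diagram 0).

Definition node_cast m n (e : m = n) (x : node m) : node n :=
  match x with inl i => inl (cast_ord e i) | inr i => inr (cast_ord e i) end.

Lemma pdiag_eq m n (e : m = n) (P : diagram m) (Q : diagram n) :
  (forall B, B \in val P -> node_cast e @: B \in val Q) ->
  Tagged diagram P = Tagged diagram Q.
Proof.
case: _ / e Q => Q hPQ.
have castE : node_cast (erefl m) =1 id.
  by case=> i /=; rewrite cast_ord_id.
have {}hPQ : {subset val P <= val Q}.
  by move=> B /hPQ; rewrite (eq_imset _ castE) imset_id.
congr existT; apply: val_inj; apply/setP => B; apply/idP/idP => [/hPQ //|BQ].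
case/and3P: (valP P) => /eqP cP tP nP; case/and3P: (valP Q) => /eqP cQ tQ nQ.
have /set0Pn[x xB] : B != set0 by apply: contraNneq nQ => <-.
have : x \in cover (val P) by rewrite cP inE.
case/bigcupP => C CP xC; suff -> : B = C by [].
apply: contraTeq xC => nBC.
have /pred0P/(_ x) /= := trivIsetP tQ _ _ BQ (hPQ _ CP) nBC.
by rewrite xB /= => ->.
Qed.

Lemma ptens0s s : ptens pempty s = s.
Proof.
case: s => n P; apply: (pdiag_eq (e := add0n n)) => B /= /setUP[] /imsetP[C].
  by rewrite inE.
move=> CP ->; rewrite -imset_comp (eq_imset (g := id)) ?imset_id //.
by case=> i /=; congr (_ _); apply: val_inj.
Qed.

Lemma ptenss0 s : ptens s pempty = s.
Proof.
case: s => n P; apply: (pdiag_eq (e := addn0 n)) => B /= /setUP[] /imsetP[C];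
  last by rewrite inE.
move=> CP ->; rewrite -imset_comp (eq_imset (g := id)) ?imset_id //.
by case=> i /=; congr (_ _); apply: val_inj.
Qed.

Lemma ptensA : associative ptens.
Proof.
move=> [i P] [j Q] [k R]; apply: (pdiag_eq (e := addnA i j k)) => B /=.
case/setUP=> /imsetP[C].
  move=> CP ->; apply/setUP; left; rewrite -imset_comp.
  apply/imsetP; exists (lnode j @: C); first by rewrite inE imset_f.
  rewrite -imset_comp; apply: eq_imset.
  by case=> x /=; congr (_ _); apply: val_inj.
case/setUP => /imsetP[D DQ ->] ->; apply/setUP; rewrite -!imset_comp.
- left; apply/imsetP; exists (@rnode i j @: D); first by rewrite inE imset_f ?orbT.
  rewrite -imset_comp; apply: eq_imset.
  by case=> x /=; congr (_ _); apply: val_inj.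
- right; apply/imsetP; exists D => //; apply: eq_imset.
  by case=> x /=; congr (_ _); apply: val_inj; rewrite /= addnA.
Qed.

Definition pdiags_of (k : nat) : seq pdiag :=
  [seq Tagged diagram P | P <- enum (diagram k)].

Definition pdiags_upto (n : nat) : seq pdiag :=
  flatten [seq pdiags_of k | k <- iota 0 n.+1].

Lemma mem_pdiags_upto n s : (s \in pdiags_upto n) = (pdiag_order s <= n)%N.
Proof.
apply/flatten_mapP/idP => [[k]|hs].
  by rewrite mem_iota add0n => /andP[_ hk] /mapP[P _ ->].
exists (pdiag_order s); first by rewrite mem_iota.
by case: s {hs} => k P; apply/mapP; exists P => //; rewrite mem_enum.
Qed.

Lemma pdiags_upto_uniq n : uniq (pdiags_upto n).
Proof.
rewrite /pdiags_upto; elim: {n}n.+1 0%N => [|n IHn] i //=.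
rewrite cat_uniq IHn andbT map_inj_uniq ?enum_uniq /=; last first.
  by move=> P Q /eqP; rewrite -tag_eqE /tag_eq /= eqxx tagged_asE => /eqP.
apply/hasPn => s /flatten_mapP[k]; rewrite mem_iota => /andP[hk _] /mapP[P _ ->].
by apply/mapP => -[Q _ /(congr1 pdiag_order)] /= ki; rewrite ki ltnn in hk.
Qed.

(* All pairs (p, r) with p (x) r = s; their orders are at most that of s. *)
Definition decomps (s : pdiag) : seq (pdiag * pdiag) :=
  [seq t <- [seq (p, r) | p <- pdiags_upto (pdiag_order s), r <- pdiags_upto (pdiag_order s)]
     | ptens t.1 t.2 == s].

Lemma mem_decomps s t : (t \in decomps s) = (ptens t.1 t.2 == s).
Proof.
rewrite mem_filter andb_idr // => /eqP <-; apply/allpairsP; exists t.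
by rewrite !mem_pdiags_upto /pdiag_order /= leq_addr leq_addl -surjective_pairing.
Qed.

Lemma decomps_uniq s : uniq (decomps s).
Proof.
rewrite filter_uniq // allpairs_uniq ?pdiags_upto_uniq //.
by move=> [? ?] [? ?].
Qed.

Section ParQSym.
Context (K : fieldType).

(* The basis vector << s >> is M_s. *)
Definition comulM (s : pdiag) : {freeg (pdiag * pdiag) / K} :=
  \sum_(t <- decomps s) tens << t.1 >> << t.2 >>.

Definition counitM (s : pdiag) : K^o := (s == pempty)%:R.

Lemma tensM (A B : choiceType) (a : A) (b : B) :
  tens << a >> << b >> = << (a, b) >> :> {freeg (A * B) / K}.
Proof. by rewrite /tens !fgliftM. Qed.

Lemma comulME s : comulM s = \sum_(t <- decomps s) << t >>.
Proof. by apply: eq_bigr => -[p r] _; rewrite tensM. Qed.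

Lemma tens_suml (A B : choiceType) I (r : seq I) (F : I -> {freeg A / K})
  (y : {freeg B / K}) : tens (\sum_(i <- r) F i) y = \sum_(i <- r) tens (F i) y.
Proof. exact: raddf_sum. Qed.

Lemma tensM_sumr (A B : choiceType) I (r : seq I) (a : A)
    (F : I -> {freeg B / K}) :
  tens << a >> (\sum_(i <- r) F i) = \sum_(i <- r) tens << a >> (F i).
Proof.
by rewrite /tens fgliftM raddf_sum; apply: eq_bigr => i _; rewrite fgliftM.
Qed.

Lemma parqsym_coassocM s :
  tassoc (tmap (fglift comulM) id (comulM s)) = tmap id (fglift comulM) (comulM s).
Proof.
rewrite comulME /tmap /tassoc !raddf_sum /=.
under eq_bigr => t _ do
  rewrite fgliftM fgliftM comulME tens_suml raddf_sum /=.
under [RHS]eq_bigr => t _ do rewrite fgliftM fgliftM comulME tensM_sumr.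
pose L := [seq (u.1, (u.2, t.2)) | t <- decomps s, u <- decomps t.1].
pose R := [seq (t.1, u) | t <- decomps s, u <- decomps t.2].
transitivity (\sum_(x <- L) << x >> : {freeg (pdiag * (pdiag * pdiag)) / K}).
  rewrite big_allpairs_dep; apply: eq_bigr => t _; apply: eq_bigr => u _.
  by rewrite tensM fgliftM.
transitivity (\sum_(x <- R) << x >> : {freeg (pdiag * (pdiag * pdiag)) / K}); last first.
  rewrite big_allpairs_dep; apply: eq_bigr => t _; apply: eq_bigr => u _.
  by rewrite tensM.
apply: perm_big; apply: uniq_perm.
- apply: allpairs_uniq_dep => [|t _|]; rewrite ?decomps_uniq //.
  move=> _ _ /allpairsPdep[t1 [u1 [_ + ->]]] /allpairsPdep[t2 [u2 [_ + ->]]].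
  case: t1 t2 u1 u2 => [p1 r1] [p2 r2] [a1 b1] [a2 b2] /=.
  by rewrite !mem_decomps /= => /eqP <- /eqP <- [-> -> ->].
- apply: allpairs_uniq_dep => [|t _|]; rewrite ?decomps_uniq //.
  move=> _ _ /allpairsPdep[t1 [u1 [_ + ->]]] /allpairsPdep[t2 [u2 [_ + ->]]].
  case: t1 t2 u1 u2 => [p1 r1] [p2 r2] [a1 b1] [a2 b2] /=.
  by rewrite !mem_decomps /= => /eqP <- /eqP <- [-> -> ->].
- move=> [a [b c]]; apply/allpairsPdep/allpairsPdep => -[[p r] [[u v]]] [];
    rewrite !mem_decomps /= => /eqP <- /eqP <- [-> -> ->].
    by exists (u, ptens v r), (v, r); rewrite !mem_decomps /= ptensA !eqxx.
  by exists (ptens p u, v), (p, u); rewrite !mem_decomps /= ptensA !eqxx.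
Qed.

Fact parqsym_coassoc x :
  tassoc (tmap (fglift comulM) id (fglift comulM x))
  = tmap id (fglift comulM) (fglift comulM x).
Proof.
refine (fglift_linear_ext
  (f := @tassoc K _ _ _ \o tmap (fglift comulM) id \o fglift comulM)
  (g := tmap id (fglift comulM) \o fglift comulM) _ x) => s.
have := parqsym_coassocM s; rewrite -(fgliftM comulM); exact.
Qed.

Lemma sum_decomps1 s t (c : pdiag * pdiag -> K) (F : pdiag * pdiag -> pdiag) :
    t \in decomps s -> F t = s ->
    (forall u, u \in decomps s -> c u = (u == t)%:R) ->
  \sum_(u <- decomps s) c u *: << F u >> = << s >> :> {freeg pdiag / K}.
Proof.
move=> ts Ft hc; rewrite (bigD1_seq t) ?decomps_uniq //= hc // eqxx scale1r Ft.
rewrite big_seq_cond big1 ?addr0 // => u /andP[/hc -> /negPf ->].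
by rewrite scale0r.
Qed.

Fact parqsym_counitl x :
  fglift (fun p => fglift counitM << p.1 >> *: << p.2 >>) (fglift comulM x) = x.
Proof.
refine (fglift_linear_ext
  (f := fglift (fun p => fglift counitM << p.1 >> *: << p.2 >>)
          \o fglift comulM) (g := idfun) _ x) => s.
rewrite /= fgliftM comulME raddf_sum /=.
under eq_bigr => t _ do rewrite !fgliftM.
apply: (sum_decomps1 (t := (pempty, s))); rewrite ?mem_decomps ?ptens0s //.
move=> [p r]; rewrite mem_decomps xpair_eqE /counitM /=.
by case: (eqVneq p pempty) => //= ->; rewrite ptens0s => ->.
Qed.

Fact parqsym_counitr x :
  fglift (fun p => fglift counitM << p.2 >> *: << p.1 >>) (fglift comulM x) = x.
Proof.
refine (fglift_linear_ext
  (f := fglift (fun p => fglift counitM << p.2 >> *: << p.1 >>)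
          \o fglift comulM) (g := idfun) _ x) => s.
rewrite /= fgliftM comulME raddf_sum /=.
under eq_bigr => t _ do rewrite !fgliftM.
apply: (sum_decomps1 (t := (s, pempty))); rewrite ?mem_decomps ?ptenss0 //.
move=> [p r]; rewrite mem_decomps xpair_eqE /counitM /= andbC.
by case: (eqVneq r pempty) => //= ->; rewrite ptenss0 => ->.
Qed.

Definition ParQSym : coalgebra K :=
  @Coalgebra K pdiag (fglift comulM) (fglift counitM)
    parqsym_coassoc parqsym_counitl parqsym_counitr.

(* Projection of ParQSym onto its component of degree n. *)
Definition hcomp (n : nat) : {freeg pdiag / K} -> {freeg pdiag / K} :=
  fglift (fun s => if pdiag_order s == n then << s >> else 0).

(* D is the direct sum of its intersections with the homogeneous components. *)
Definition is_graded (D : {freeg pdiag / K} -> Prop) : Prop :=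
  forall n x, D x -> D (hcomp n x).

Definition spanM (p : pred pdiag) : {freeg pdiag / K} -> Prop :=
  in_span (fun x => exists2 s, p s & x = << s >>).

End ParQSym.

Arguments spanM K p : clear implicits.

Definition propagating k (B : {set node k}) : bool :=
  [exists i, inl i \in B] && [exists i, inr i \in B].

Definition matching (s : pdiag) : bool :=
  [forall B in blocks s, #|B| <= 2]%N.

Definition perfect_matching (s : pdiag) : bool :=
  [forall B in blocks s, #|B| == 2]%N.

Definition permuting (s : pdiag) : bool :=
  [forall B in blocks s, (#|B| == 2) && propagating B]%N.

Definition partial_permutation (s : pdiag) : bool :=
  [forall B in blocks s,
    ((#|B| == 1) || (#|B| == 2)) && ((#|B| == 2) ==> propagating B)]%N.

(* Main.v *)
(* Each of the four classes is cut out by a condition on the blocks that is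
   invariant under shifting labels.  The blocks of [pi (x) rho] are the shifted
   blocks of [pi] and of [rho], so if [pi (x) rho] is in the class then so are
   [pi] and [rho], and every term of the coproduct of a basis vector of the span
   is a tensor product of two basis vectors of the span. *)

Require Import Defs.
From mathcomp Require Import all_boot all_algebra.
From mathcomp.multinomials Require Import freeg.

Set Implicit Arguments.
Unset Strict Implicit.
Unset Printing Implicit Defensive.

Import GRing.Theory.
Local Open Scope ring_scope.

Section Span.
Context (K : fieldType) (V : lmodType K).

Lemma subspaceZ (D : V -> Prop) c x : is_subspace D -> D x -> D (c *: x).
Proof. by case=> D0 DL Dx; rewrite -[_ *: _]addr0; apply: DL. Qed.

(** The terms are tested only at indices occurring in [r]: in a sum over [decomps s], membership
    carries the equation [ptens a b = s]. *)
Lemma subspace_sum (D : V -> Prop) (I : eqType) (r : seq I) (F : I -> V) :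
  is_subspace D -> (forall i, i \in r -> D (F i)) -> D (\sum_(i <- r) F i).
Proof.
case=> D0 DL DF; rewrite big_seq; elim/big_ind: _ => // x y Dx Dy.
by rewrite -[x]scale1r; apply: DL.
Qed.

Lemma in_span_subspace (S : V -> Prop) : is_subspace (in_span S).
Proof.
split.
  by exists 0%N, (fun=> 0), (fun=> 0); rewrite big_ord0; split=> // -[].
move=> c _ _ [m [a [s [Ss ->]]]] [n [b [t [St ->]]]].
(* Concatenate the two families, absorbing the scalar [c] into the coefficients of the first. *)
exists (m + n)%N.
exists (fun i => match split i with inl j => c * a j | inr j => b j end).
exists (fun i => match split i with inl j => s j | inr j => t j end).
split=> [i|]; first by case: split.
rewrite big_split_ord scaler_sumr /=; congr (_ + _); apply: eq_bigr => i _.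
  by rewrite (unsplitK (inl i)) scalerA.
by rewrite (unsplitK (inr i)).
Qed.

Lemma mem_span (S : V -> Prop) x : S x -> in_span S x.
Proof.
by move=> Sx; exists 1%N, (fun=> 1), (fun=> x); rewrite big_ord1 scale1r.
Qed.

End Span.

(** Linearity reduces a claim about a whole span to its generators; this serves both for the
    projections [hcomp n] and for the coproduct. *)
Lemma span_image (K : fieldType) (V W : lmodType K) (S : V -> Prop)
    (D : W -> Prop) (f : {linear V -> W}) :
  is_subspace D -> (forall s, S s -> D (f s)) ->
  forall x, in_span S x -> D (f x).
Proof.
move=> subD Sf _ [n [c [s [Ss ->]]]]; rewrite raddf_sum.
apply: subspace_sum => // i _; rewrite /= linearZZ; apply: subspaceZ => //.
exact: Sf.
Qed.

Section SpanM.
Context (K : fieldType) (p : pred pdiag).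

(** Basis vectors are homogeneous: [hcomp n] sends each one to itself or to 0, whatever the
    predicate [p]. *)
Lemma spanM_graded : is_graded (spanM K p).
Proof.
move=> n; apply: (span_image (D := spanM K p) (f := fglift _)).
  exact: in_span_subspace.
move=> _ [s ps ->]; rewrite /= fgliftM; case: ifP => _.
  by apply: mem_span; exists s.
have [] // := in_span_subspace
  (fun x : {freeg pdiag / K} => exists2 s, p s & x = << s >>).
Qed.

Lemma spanM_subcoalgebra :
  (forall a b, p (ptens a b) -> p a && p b) ->
  is_subcoalgebra (C := ParQSym K) (spanM K p).
Proof.
move=> p_tens; split; first exact: in_span_subspace.
apply: (span_image (D := tens_sub (spanM K p)) (f := comul (ParQSym K))).
  exact: in_span_subspace.
move=> _ [s ps ->]; rewrite /= fgliftM.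
apply: (subspace_sum (D := tens_sub (spanM K p))).
  exact: in_span_subspace.
(* Each term of [comulM s] is already a pure tensor, so it suffices that both factors satisfy
   [p]. *)
move=> [a b]; rewrite mem_decomps /= => /eqP def_s.
have /andP[pa pb] : p a && p b by apply: p_tens; rewrite def_s.
apply: mem_span; exists << a >>, << b >>.
by split=> //; apply: mem_span; [exists a | exists b].
Qed.

End SpanM.

(** A block of either factor, once shifted, is a block of the product, and invariance carries [q]
    back along the shift. The condition is a family over all orders because the three diagrams have
    different node types. *)
Lemma forall_blocks_ptens (q : forall k, {set node k} -> bool) :
  (forall k m (B : {set node k}), q _ (lnode m @: B) = q _ B) ->
  (forall k m (B : {set node m}), q _ (@rnode k m @: B) = q _ B) ->
  forall a b, [forall B in blocks (ptens a b), q _ B] ->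
    [forall B in blocks a, q _ B] && [forall B in blocks b, q _ B].
Proof.
move=> ql qr [k P] [m Q] /forall_inP qPQ.
apply/andP; split; apply/forall_inP => B hB.
  by rewrite -(ql k m); apply: qPQ; rewrite inE imset_f.
by rewrite -(qr k m); apply: qPQ; rewrite inE imset_f ?orbT.
Qed.

Lemma card_lnode k m (B : {set node k}) : #|lnode m @: B| = #|B|.
Proof. exact/card_imset/lnode_inj. Qed.

Lemma card_rnode k m (B : {set node m}) : #|@rnode k m @: B| = #|B|.
Proof. exact/card_imset/rnode_inj. Qed.

(** The shift maps upper nodes to upper nodes and lower nodes to lower nodes, so each half of the
    condition is preserved separately. *)
Lemma propagating_lnode k m (B : {set node k}) :
  propagating (lnode m @: B) = propagating B.
Proof.
congr andb; apply/existsP/existsP => -[i].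
- by case/imsetP=> -[] // j jB _; exists j.
- by move=> iB; exists (lshift m i); apply/imsetP; exists (inl i).
- by case/imsetP=> -[] // j jB _; exists j.
- by move=> iB; exists (lshift m i); apply/imsetP; exists (inr i).
Qed.

Lemma propagating_rnode k m (B : {set node m}) :
  propagating (@rnode k m @: B) = propagating B.
Proof.
congr andb; apply/existsP/existsP => -[i].
- by case/imsetP=> -[] // j jB _; exists j.
- by move=> iB; exists (rshift k i); apply/imsetP; exists (inl i).
- by case/imsetP=> -[] // j jB _; exists j.
- by move=> iB; exists (rshift k i); apply/imsetP; exists (inr i).
Qed.

Theorem theorem3p4 (K : fieldType) :
  [/\ is_graded (spanM K matching)
       /\ is_subcoalgebra (C := ParQSym K) (spanM K matching),
     is_graded (spanM K perfect_matching)
       /\ is_subcoalgebra (C := ParQSym K) (spanM K perfect_matching),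
     is_graded (spanM K permuting)
       /\ is_subcoalgebra (C := ParQSym K) (spanM K permuting)
   & is_graded (spanM K partial_permutation)
       /\ is_subcoalgebra (C := ParQSym K) (spanM K partial_permutation)].
Proof.
split; (split; first exact: spanM_graded); apply: spanM_subcoalgebra.
(* The first two conditions involve only block sizes, which injective shifts preserve; the last two
   also use invariance of [propagating]. *)
- apply: (forall_blocks_ptens (q := fun k B => #|B| <= 2)%N) => k m B;
    by rewrite ?card_lnode ?card_rnode.
- apply: (forall_blocks_ptens (q := fun k B => #|B| == 2)%N) => k m B;
    by rewrite ?card_lnode ?card_rnode.
- apply: (forall_blocks_ptens
    (q := fun k B => (#|B| == 2) && propagating B)%N) => k m B;
    by rewrite ?card_lnode ?card_rnode ?propagating_lnode ?propagating_rnode.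
- apply: (forall_blocks_ptens
    (q := fun k B => ((#|B| == 1) || (#|B| == 2))
                       && ((#|B| == 2) ==> propagating B))%N) => k m B;
    by rewrite ?card_lnode ?card_rnode ?propagating_lnode ?propagating_rnode.
Qed.
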